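(* Let $0<\delta\le\frac12$, $0<C<\frac34$ and $0<B<\dfrac{1}{\sqrt{\frac C3-\frac{C^2}3}+C}$. For each (sufficiently large) $n$ let $X=X^{(n)}=(X_{ij})$ be uniformly distributed on the set $\mathscr{M}^{\{0,1\}}_{n,\delta}(B,C)$ of binary contingency tables, all these random matrices being defined on a common probability space, and let $$S^{\mathbf S}_{n,\delta}(B,C):=\sum_{k=1}^{n}X_{1,k+[n^\delta]}.$$ Then, as $n\to\infty$, $$\frac1n S^{\mathbf S}_{n,\delta}(B,C)\to BC\qquad\text{almost surely.}$$
   Context: $[x]$ denotes the integer part of $x$. For integer vectors $\mathbf r=(r_1,\dots,r_m)$, $\mathbf c=(c_1,\dots,c_l)$ with $\sum_i r_i=\sum_j c_j$, $\mathscr{M}^{\{0,1\}}(\mathbf r,\mathbf c)$ is the set of $m\times l$ matrices with entries in $\{0,1\}$ whose $i$th row sum is $r_i$ and $j$th column sum is $c_j$ for all $i,j$. For $B,C>0$, $0\le\delta\le1$ and $n\ge1$, $\mathscr{M}^{\{0,1\}}_{n,\delta}(B,C):=\mathscr{M}^{\{0,1\}}(\widetilde{\mathbf r},\widetilde{\mathbf c})$, where $\widetilde{\mathbf r}=\widetilde{\mathbf c}\in\mathbb N^{[n^\delta]+n}$ is the vector whose first $[n^\delta]$ entries equal $[BCn]$ and whose remaining $n$ entries equal $[Cn]$. *)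

(* Defs.v *)
From HB Require Import structures.
From mathcomp Require Import all_boot all_order all_algebra.
From mathcomp Require Import all_classical all_reals all_analysis.
Import Order.TTheory GRing.Theory Num.Theory.
Import numFieldNormedType.Exports.
Set Implicit Arguments.
Unset Strict Implicit.
Unset Printing Implicit Defensive.
Local Open Scope classical_set_scope.
Local Open Scope ring_scope.

(* The entries 0 and 1 are encoded by bool and summed through the coercion
   to nat. *)
Definition binary_tables (m l : nat) (r : 'I_m -> nat) (c : 'I_l -> nat) :
    {set 'M[bool]_(m, l)} :=
  [set A : 'M[bool]_(m, l) |
     [forall i, (\sum_j (A i j : nat))%N == r i] &&
     [forall j, (\sum_i (A i j : nat))%N == c j]]%SET.

(* Num.truncn is the integer part on nonnegative reals (and 0 on negative
   ones); it is only applied to nonnegative arguments here. *)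
Definition n_delta (R : realType) (delta : R) (n : nat) : nat :=
  Num.truncn (n%:R `^ delta).

Definition margin (R : realType) (B C delta : R) (n : nat)
    (i : 'I_(n_delta delta n + n)) : nat :=
  if (i < n_delta delta n)%N then Num.truncn (B * C * n%:R)
  else Num.truncn (C * n%:R).

Definition binary_tables_ndelta (R : realType) (B C delta : R) (n : nat) :
    {set 'M[bool]_(n_delta delta n + n)} :=
  binary_tables (@margin R B C delta n) (@margin R B C delta n).

(* If M is empty the right-hand side vanishes for U the full set, so no
   random element is uniform on the empty set. *)
Definition uniform_on d (T : measurableType d) (R : realType)
    (P : probability T R) (E : finType) (X : T -> E) (M : {set E}) : Prop :=
  forall U : {set E}, measurable (X @^-1` [set` U]) /\
    P (X @^-1` [set` U]) = (#|U :&: M|%:R / #|M|%:R)%:E.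

(* The index 0 of 'I_N, any k : 'I_N witnessing that N is positive. *)
Definition ord_first (N : nat) (k : 'I_N) : 'I_N :=
  Ordinal (leq_ltn_trans (leq0n k) (ltn_ord k)).

(* Indices start from 0: the row is the first one and rshift t k is the column
   k + t, so that the last n columns are summed. *)
Definition S_side (t n : nat) (A : 'M[bool]_(t + n)) : nat :=
  (\sum_(k < n) (A (ord_first (rshift t k)) (rshift t k) : nat))%N.

(* Main.v *)
Require Import Defs.
From HB Require Import structures.
From mathcomp Require Import all_boot all_order all_algebra.
From mathcomp Require Import all_classical all_reals all_analysis.
Import Order.TTheory GRing.Theory Num.Theory.
Import numFieldNormedType.Exports.
Local Open Scope classical_set_scope.
Local Open Scope ring_scope.

(** The sum in question is almost deterministic.  The first row of a table has
    total exactly [BCn], and its first t = [n^delta] entries, being 0 or 1,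
    contribute at most t.  Hence every table in the support of the uniform law
    satisfies
      [BCn] - t <= S <= [BCn]   ([S_side_first_row]),
    and since t = o(n) as soon as delta < 1 ([powR_natr_div_cvg0]), S / n tends
    to BC along every sequence of such tables.  What remains of probability
    theory is that X^(n) lies in the set of tables almost surely
    ([uniform_on_ae]), for all large n at once because a countable union of
    null sets is null. *)

(** The set cannot be empty, for the full set of outcomes would then get
    probability 0; so it gets the same probability as the full set. *)
Lemma uniform_on_ae d (T : measurableType d) (R : realType)
    (P : probability T R) (E : finType) (X : T -> E) (M : {set E}) :
  uniform_on P X M -> {ae P, forall w, X w \in M}.
Proof.
move=> X_unif; have [mXM PXM] := X_unif M.
have PXM1 : P (X @^-1` [set` M]) = 1%E.
  have [_] := X_unif [set: E]%SET.
  have -> : X @^-1` [set` [set: E]%SET] = setT.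
    by apply/seteqP; split=> // w _ /=; rewrite finset.inE.
  by rewrite PXM finset.setIid finset.setTI => <-; exact: probability_setT.
exists (~` (X @^-1` [set` M])); split => //; first exact: measurableC.
by rewrite probability_setC // PXM1 subee.
Qed.

Lemma S_side_first_row (t n : nat) (r c : 'I_(t + n) -> nat)
    (A : 'M[bool]_(t + n)) (k : 'I_n) :
  A \in binary_tables r c ->
  (S_side A <= r (ord_first (rshift t k)) <= S_side A + t)%N.
Proof.
rewrite finset.inE => /andP[/forallP rowA _].
have S_rowE : S_side A =
    (\sum_(j < n) (A (ord_first (rshift t k)) (rshift t j) : nat))%N.
  by apply: eq_bigr => j _; congr (A _ _ : nat); exact: val_inj.
rewrite -(eqP (rowA (ord_first (rshift t k)))) big_split_ord /= -S_rowE.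
rewrite leq_addl addnC leq_add2l -[leqRHS]muln1 -[X in (_ <= X * _)%N]card_ord.
by rewrite -sum_nat_const; apply: leq_sum => j _; exact: leq_b1.
Qed.

(** So that row 0 is one of the heavy rows, of total [BCn]. *)
Lemma n_delta_gt0 (R : realType) (delta : R) (n : nat) :
  0 <= delta -> (0 < n)%N -> (0 < n_delta delta n)%N.
Proof.
move=> delta_ge0 n_gt0; rewrite /n_delta truncn_gt0.
have n_ge1 : 1 <= n%:R :> R by rewrite ler1n.
by rewrite -[leLHS](powRr0 n%:R) ler_powR.
Qed.

(** As n^delta / n = (1/n)^(1 - delta), this is the continuity at 0 of a
    positive power. *)
Lemma powR_natr_div_cvg0 (R : realType) (delta : R) : delta < 1 ->
  (n%:R `^ delta) / n%:R @[n --> \oo] --> (0 : R).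
Proof.
move=> delta_lt1; rewrite -cvg_shiftS /=.
have -> : (fun n => n.+1%:R `^ delta / n.+1%:R) =
    (fun n => harmonic n `^ (1 - delta)) :> (nat -> R).
  apply/funext => n /=.
  rewrite -[n.+1%:R^-1 in RHS]powR_inv1 // -powRrM mulN1r opprB.
  by rewrite powRB ?powRr1 // pnatr_eq0 implybT.
have powR_cvg : a `^ (1 - delta) @[a --> (0 : R)^'+] --> (0 : R).
  by apply: powR_cvg0; rewrite subr_gt0.
apply: (cvg_at_rightP _ _ _).1 powR_cvg harmonic _; split.
  by move=> n; exact: harmonic_gt0.
exact: cvg_harmonic.
Qed.

(** Rounding [BCn] down costs at most 1, and the first t columns at most t. *)
Lemma S_side_ndelta_bounds (R : realType) (B C delta : R) (n : nat)
    (A : 'M[bool]_(n_delta delta n + n)) :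
  0 <= B * C -> 0 <= delta -> (0 < n)%N ->
  A \in binary_tables_ndelta B C delta n ->
  B * C - (n%:R^-1 + n%:R `^ delta / n%:R) <= (S_side A)%:R / n%:R <= B * C.
Proof.
move=> BC_ge0 delta_ge0 n_gt0 /(S_side_first_row _ _ _ _ _ (Ordinal n_gt0)).
rewrite /margin /= n_delta_gt0 //.
set b := Num.truncn _; set t := n_delta _ _ => /andP[S_le S_ge].
have nR_gt0 : 0 < n%:R :> R by rewrite ltr0n.
have /truncn_itv/andP[b_le b_gt] : 0 <= B * C * n%:R by rewrite mulr_ge0.
have t_le : t%:R <= n%:R `^ delta by rewrite truncn_le powR_ge0.
apply/andP; split; last first.
  by rewrite ler_pdivrMr //; apply: le_trans b_le; rewrite ler_nat.
rewrite ler_pdivlMr // mulrBl mulrDl mulVf ?gt_eqF // divfK ?gt_eqF //.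
move: S_ge; rewrite -(ler_nat R) natrD => S_ge.
rewrite lerBlDr addrCA; apply: le_trans (ltW b_gt) _.
by rewrite -[leLHS]nat1r lerD2l (le_trans S_ge) // lerD2l.
Qed.

Theorem theorem1p5 (R : realType) (delta B C : R)
    (delta_gt0 : 0 < delta) (delta_le : delta <= 1 / 2)
    (C_gt0 : 0 < C) (C_lt : C < 3 / 4)
    (B_gt0 : 0 < B) (B_lt : B < 1 / (Num.sqrt (C / 3 - C ^+ 2 / 3) + C))
    (d : measure_display) (T : measurableType d) (P : probability T R)
    (X : forall n : nat, T -> 'M[bool]_(n_delta delta n + n))
    (X_unif : \forall n \near \oo,
      uniform_on P (X n) (binary_tables_ndelta B C delta n)) :
  {ae P, forall w : T,
    (S_side (X n w))%:R / n%:R @[n --> \oo] --> B * C}.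
Proof.
have [N _ unifN] := X_unif.
have tables_ae : {ae P, forall w, forall n, (N <= n)%N ->
    X n w \in binary_tables_ndelta B C delta n}.
  apply: ae_foralln => n; case: (leqP N n) => [Nn|_]; last first.
    exact: aeW.
  by apply: filterS (uniform_on_ae _ _ _ _ _ _ _ (unifN n Nn)).
apply: filterS tables_ae => w tables_w.
have delta_lt1 : delta < 1.
  by apply: le_lt_trans delta_le _; rewrite ltr_pdivrMr // mul1r ltr1n.
have error_cvg : n%:R^-1 + n%:R `^ delta / n%:R @[n --> \oo] --> (0 : R).
  rewrite -[X in _ --> X]addr0; apply: cvgD; last exact: powR_natr_div_cvg0.
  by rewrite -cvg_shiftS; exact: cvg_harmonic.
apply: (@squeeze_cvgr _ _ _ _
  (fun n => B * C - (n%:R^-1 + n%:R `^ delta / n%:R)) (fun=> B * C)).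
- near=> n; apply: S_side_ndelta_bounds; first by rewrite mulr_ge0 ?ltW.
  + exact: ltW.
  + by near: n; exact: nbhs_infty_gt.
  + by apply: tables_w; near: n; exact: nbhs_infty_ge.
- by rewrite -[X in _ --> X]subr0; apply: cvgB => //; exact: cvg_cst.
- exact: cvg_cst.
Unshelve. all: by end_near.
Qed.
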